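(* (a) Let $F\in\mathcal X\cup\{\alpha,\Theta\}$. The function $\mathbb Q_{\ge2}\to\mathbb R:\ p/q\mapsto F(E_{p/q})$ is right-continuous. (b) The right-continuity in (a) is uniform over $\mathcal X$: for each $p'/q'\in\mathbb Q_{\ge2}$ and each $\varepsilon>0$ there is a $\delta>0$ such that $$F(E_{p'/q'})\le F(E_{p/q})<F(E_{p'/q'})+\varepsilon$$ for all $F\in\mathcal X$ and all $p/q\in\mathbb Q_{\ge2}$ with $p'/q'\le p/q<p'/q'+\delta$. (c) Let $a/b \in \mathbb Q_{\ge 2}$. If $p_n/q_n$ converges to $a/b$ from above (that is, $p_n/q_n\ge a/b$ for all $n$ and $p_n/q_n\to a/b$), then $E_{p_n/q_n}$ converges to $E_{a/b}$ in the asymptotic spectrum distance.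
   Context: Graphs here are finite and simple. $E_n$ denotes the graph with $n$ vertices and no edges, $G\sqcup H$ the disjoint union, and $G\boxtimes H$ the strong product: its vertex set is $V(G)\times V(H)$, and distinct $(a,x),(b,y)$ are adjacent iff ($a=b$ or $\{a,b\}\in E(G)$) and ($x=y$ or $\{x,y\}\in E(H)$). A cohomomorphism $G\to H$ is a map $f:V(G)\to V(H)$ such that for all distinct non-adjacent $u,v\in V(G)$ the vertices $f(u),f(v)$ are distinct and non-adjacent in $H$. Write $G\le H$ if there is a cohomomorphism $G\to H$. $\alpha$ is the independence number, and $\Theta(G)=\lim_{n\to\infty}\alpha(G^{\boxtimes n})^{1/n}$ is the Shannon capacity. The asymptotic spectrum of graphs $\mathcal X$ is the set of all maps $F$ from finite graphs to $\mathbb R_{\ge 0}$ with $F(G\sqcup H)=F(G)+F(H)$, $F(G\boxtimes H)=F(G)F(H)$, $F(E_n)=n$ for all $n\in\mathbb N$, and $G\le H\Rightarrow F(G)\le F(H)$. The asymptotic spectrum distance is $d(G,H)=\sup_{F\in\mathcal X}|F(G)-F(H)|$, and $G_i$ converges to $H$ if $d(G_i,H)\to 0$. For positive integers $p,q$ with $p/q\ge 2$, the fraction graph $E_{p/q}$ has vertex set $\{0,\dots,p-1\}$, and distinct $u,v$ are adjacent iff $u-v \bmod p<q$ or $v-u\bmod p<q$. If $p/q=p'/q'$ as rational numbers then $E_{p/q}\le E_{p'/q'}\le E_{p/q}$, so $F(E_{p/q})$ depends only on the rational number $p/q$ for $F\in\mathcal X\cup\{\alpha,\Theta\}$. *)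

(* Defs.v *)
From HB Require Import structures.
From mathcomp Require Import all_boot all_order all_algebra.
From mathcomp Require Import all_classical all_reals all_analysis.

Set Implicit Arguments.
Unset Strict Implicit.
Unset Printing Implicit Defensive.

Import Order.TTheory GRing.Theory Num.Theory numFieldNormedType.Exports.
Local Open Scope classical_set_scope.
Local Open Scope ring_scope.

Record sgraph := SGraph {
  vertex :> finType;
  adj : rel vertex;
  adj_sym : symmetric adj;
  adj_irrefl : irreflexive adj }.

Lemma edgeless_sym n : symmetric (fun _ _ : 'I_n => false).
Proof. by []. Qed.

Lemma edgeless_irrefl n : irreflexive (fun _ _ : 'I_n => false).
Proof. by []. Qed.

Definition edgeless (n : nat) : sgraph :=
  SGraph (@edgeless_sym n) (@edgeless_irrefl n).

Section Operations.
Variables G H : sgraph.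

Definition union_adj : rel (G + H)%type := fun u v =>
  match u, v with
  | inl a, inl b => adj a b
  | inr x, inr y => adj x y
  | _, _ => false
  end.

Lemma union_adj_sym : symmetric union_adj.
Proof. by case=> [a|x] [b|y] //=; rewrite adj_sym. Qed.

Lemma union_adj_irrefl : irreflexive union_adj.
Proof. by case=> [a|x] /=; rewrite adj_irrefl. Qed.

Definition disjoint_union : sgraph := SGraph union_adj_sym union_adj_irrefl.

Definition strong_adj : rel (G * H)%type := fun u v =>
  [&& u != v, (u.1 == v.1) || adj u.1 v.1 & (u.2 == v.2) || adj u.2 v.2].

Lemma strong_adj_sym : symmetric strong_adj.
Proof.
move=> u v; rewrite /strong_adj eq_sym [u.1 == _]eq_sym [u.2 == _]eq_sym.
by rewrite [adj u.1 _]adj_sym [adj u.2 _]adj_sym.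
Qed.

Lemma strong_adj_irrefl : irreflexive strong_adj.
Proof. by move=> u; rewrite /strong_adj eqxx. Qed.

Definition strong_prod : sgraph := SGraph strong_adj_sym strong_adj_irrefl.

Definition cohomomorphism (f : G -> H) : Prop :=
  forall u v : G, u != v -> ~~ adj u v -> f u != f v /\ ~~ adj (f u) (f v).

Definition cohom_le : Prop := exists f : G -> H, cohomomorphism f.

End Operations.

Definition strong_pow (G : sgraph) (n : nat) : sgraph :=
  iter n (strong_prod G) (edgeless 1).

Definition independent (G : sgraph) (A : {set G}) : bool :=
  [forall u in A, forall v in A, ~~ adj u v].

Definition alpha (G : sgraph) : nat :=
  \max_(A : {set G} | independent A) #|A|.

(* For u, v < p, the natural number u + (p - v) is congruent to u - v mod p. *)
Definition frac_adj (p q : nat) : rel 'I_p := fun u v =>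
  (u != v) &&
  (((u + (p - v)) %% p < q)%N || ((v + (p - u)) %% p < q)%N).

Lemma frac_adj_sym p q : symmetric (@frac_adj p q).
Proof. by move=> u v; rewrite /frac_adj eq_sym orbC. Qed.

Lemma frac_adj_irrefl p q : irreflexive (@frac_adj p q).
Proof. by move=> u; rewrite /frac_adj eqxx. Qed.

Definition fraction_graph (p q : nat) : sgraph :=
  SGraph (@frac_adj_sym p q) (@frac_adj_irrefl p q).

Definition frac_ge2 (p q : nat) : bool :=
  [&& (0 < p)%N, (0 < q)%N & 2 <= p%:R / q%:R :> rat].

Section Spectrum.
Variable R : realType.

Definition independence_number (G : sgraph) : R := (alpha G)%:R.

Definition shannon_capacity (G : sgraph) : R :=
  limn (fun n : nat => independence_number (strong_pow G n) `^ (n%:R^-1)).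

(* The asymptotic spectrum is a predicate rather than a [set]: [sgraph] is too
   large for the universe of [set]. *)
Record asymptotic_spectrum (F : sgraph -> R) : Prop := SpectralPoint {
  spectral_ge0 : forall G, 0 <= F G;
  spectral_union : forall G H, F (disjoint_union G H) = F G + F H;
  spectral_prod : forall G H, F (strong_prod G H) = F G * F H;
  spectral_edgeless : forall n, F (edgeless n) = n%:R;
  spectral_le : forall G H, cohom_le G H -> F G <= F H }.

Lemma spectral_le_card (F : sgraph -> R) (G : sgraph) :
  asymptotic_spectrum F -> F G <= #|G|%:R.
Proof.
move=> FX; rewrite -(spectral_edgeless FX); apply: (spectral_le FX).
exists (fun u : G => enum_rank u) => u v uv _; split=> //.
by apply: contraNneq uv => /enum_rank_inj ->.
Qed.

Definition asymp_dist (G H : sgraph) : R :=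
  sup [set x : R | exists2 F, asymptotic_spectrum F & x = `|F G - F H|].

(* [sup] would default to 0 on an unbounded set (ruled out below) or on the
   empty set (the Lovasz theta function is a spectral point). *)
Lemma asymp_dist_has_ubound (G H : sgraph) :
  has_ubound [set x : R | exists2 F, asymptotic_spectrum F & x = `|F G - F H|].
Proof.
exists (#|G|%:R + #|H|%:R) => _ [F FX ->].
apply: (le_trans (ler_normB _ _)).
by rewrite !ger0_norm ?(spectral_ge0 FX) // lerD // spectral_le_card.
Qed.

Definition asymp_cvg (G_ : nat -> sgraph) (H : sgraph) : Prop :=
  asymp_dist (G_ n) H @[n --> \oo] --> (0 : R).

(* [rat^o] gives access to the usual (absolute value) topology on [rat].
   Values of [f] below 2 play no role. *)
Definition right_continuous_ge2 (f : rat -> R) : Prop :=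
  forall x : rat, 2 <= x ->
    f y @[y --> within [set y | x <= y] (nbhs (x : rat^o))] --> f x.

End Spectrum.

(* Main.v *)
Require Import Defs.
From HB Require Import structures.
From mathcomp Require Import all_boot all_order all_algebra.
From mathcomp Require Import all_classical all_reals all_analysis.
From mathcomp Require Import zify lra.

Set Implicit Arguments.
Unset Strict Implicit.
Unset Printing Implicit Defensive.

Import Order.TTheory GRing.Theory Num.Theory numFieldNormedType.Exports.
Local Open Scope classical_set_scope.
Local Open Scope ring_scope.

(** Let [a] and [b] be coprime. There are fractions [p/q] above [a/b], arbitrarily
    close to it and with [p] arbitrarily large, such that [p * b - q * a = 1]. For
    such a fraction the rounding map [u |-> floor (u * a / p)] is a
    cohomomorphism from [E_{p/q}] to [E_{a/b}] except at the vertex [0]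
    ([scale_cohom]), and since [E_{p/q}] is invariant under rotation the
    exceptional vertex can be put anywhere ([scale_rotate_cohom]).

    This loss of one vertex is negligible in powers. If [m < p], a vertex of
    [E_{p/q}^m] has only [m] coordinates, so it avoids one of [m + 1] fixed
    vertices, and the rotated map attached to that vertex can be applied to all of
    its coordinates. Hence [E_{p/q}^m <= E_{m+1} * E_{a/b}^m], with [*] the strong
    product ([fraction_pow_cover]). A spectral point turns this into
    [F(E_{p/q})^m <= (m + 1) F(E_{a/b})^m], and so does the Shannon capacity
    ([shannon_power_monotone]), once its defining limit is known to exist and to be
    a supremum ([supermul_root_cvg]). The [m]-th root of [m + 1] tends to [1] and
    [F(E_{a/b}) <= a], so [F(E_{p/q}) < F(E_{a/b}) + e] for large [m], with [m]
    depending on [a] and [e] only ([power_gap], [approx_above]). For the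
    independence number even [alpha(E_{p/q}) <= alpha(E_{a/b})] holds when
    [1 < q], because an independent set then omits a vertex
    ([fraction_alpha_le]).

    The rounding map also shows that [F(E_{p/q})] is monotone in [p/q]
    ([fraction_graph_le]), so the bound at one fraction above [a/b] holds on the
    whole interval below that fraction, uniformly in [F]
    ([uniform_right_continuity]). The three claims are readings of this fact. *)

(** * Cohomomorphisms and strong products *)

(** This is the relation that cohomomorphisms preserve; on strong products it is
    a disjunction over the two coordinates. *)
Definition apart (G : sgraph) (u v : G) : bool := (u != v) && ~~ adj u v.

Definition cohom_on (G H : sgraph) (P : {pred G}) (f : G -> H) : Prop :=
  {in P &, forall u v, apart u v -> apart (f u) (f v)}.

Lemma apart_sym (G : sgraph) : symmetric (@apart G).
Proof. by move=> u v; rewrite /apart eq_sym adj_sym. Qed.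

Lemma apart_edgeless n (i j : edgeless n) : apart i j = (i != j).
Proof. by rewrite /apart andbT. Qed.

Lemma apart_prod (G H : sgraph) (u v : strong_prod G H) :
  apart u v = apart u.1 v.1 || apart u.2 v.2.
Proof.
case: u v => [a x] [b y]; rewrite /apart /= /strong_adj /= xpair_eqE.
by have [->|_] := eqVneq a b; have [->|_] := eqVneq x y; rewrite //= ?negb_and ?orbF.
Qed.

Lemma cohom_leP (G H : sgraph) :
  cohom_le G H <-> exists f : G -> H, cohom_on predT f.
Proof.
split=> -[f fP]; exists f => u v.
  by move=> _ _ /andP[uv /(fP _ _ uv)[fuv nfuv]]; apply/andP.
by move=> uv nuv; have /andP[] : apart (f u) (f v) by apply: fP => //; apply/andP.
Qed.

Lemma cohom_le_of (G H : sgraph) (f : G -> H) :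
  (forall u v, apart u v -> apart (f u) (f v)) -> cohom_le G H.
Proof. by move=> fP; apply/cohom_leP; exists f => u v _ _; exact: fP. Qed.

Lemma cohom_le_refl (G : sgraph) : cohom_le G G.
Proof. exact: (@cohom_le_of _ _ id). Qed.

Lemma cohom_le_trans (H G K : sgraph) :
  cohom_le G H -> cohom_le H K -> cohom_le G K.
Proof.
move=> /cohom_leP[f fP] /cohom_leP[g gP].
by apply: (@cohom_le_of _ _ (g \o f)) => u v uv; apply: gP => //; apply: fP.
Qed.

Lemma strong_prod_le (G G' H H' : sgraph) :
  cohom_le G G' -> cohom_le H H' ->
  cohom_le (strong_prod G H) (strong_prod G' H').
Proof.
move=> /cohom_leP[f fP] /cohom_leP[g gP].
apply: (@cohom_le_of (strong_prod G H) (strong_prod G' H')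
  (fun u => (f u.1, g u.2))) => u v.
rewrite !apart_prod /= => /orP[uv|uv]; apply/orP.
  by left; apply: fP.
by right; apply: gP.
Qed.

Lemma strong_prod_assocl (G H K : sgraph) :
  cohom_le (strong_prod G (strong_prod H K)) (strong_prod (strong_prod G H) K).
Proof.
apply: (@cohom_le_of (strong_prod G (strong_prod H K))
  (strong_prod (strong_prod G H) K) (fun u => ((u.1, u.2.1), u.2.2))) => u v.
by rewrite !apart_prod orbA.
Qed.

Lemma strong_prod_assocr (G H K : sgraph) :
  cohom_le (strong_prod (strong_prod G H) K) (strong_prod G (strong_prod H K)).
Proof.
apply: (@cohom_le_of (strong_prod (strong_prod G H) K)
  (strong_prod G (strong_prod H K)) (fun u => (u.1.1, (u.1.2, u.2)))) => u v.
by rewrite !apart_prod orbA.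
Qed.

Lemma strong_prod_interchange (G H K L : sgraph) :
  cohom_le (strong_prod (strong_prod G H) (strong_prod K L))
           (strong_prod (strong_prod G K) (strong_prod H L)).
Proof.
apply: (@cohom_le_of (strong_prod (strong_prod G H) (strong_prod K L))
  (strong_prod (strong_prod G K) (strong_prod H L))
  (fun u => ((u.1.1, u.2.1), (u.1.2, u.2.2)))) => u v.
by rewrite !apart_prod /= orbACA.
Qed.

Lemma strong_prod_unitl (G : sgraph) :
  cohom_le (strong_prod (edgeless 1) G) G.
Proof.
apply: (@cohom_le_of (strong_prod (edgeless 1) G) G snd) => u v.
by rewrite apart_prod apart_edgeless (ord1 u.1) (ord1 v.1).
Qed.

Lemma strong_prod_unitl_ge (G : sgraph) :
  cohom_le G (strong_prod (edgeless 1) G).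
Proof.
apply: (@cohom_le_of G (strong_prod (edgeless 1) G) (fun u => (ord0, u))) => u v.
by move=> uv; rewrite apart_prod uv orbT.
Qed.

Lemma strong_pow_le (G H : sgraph) n :
  cohom_le G H -> cohom_le (strong_pow G n) (strong_pow H n).
Proof.
move=> GH; elim: n => [|n IHn]; first exact: cohom_le_refl.
exact: strong_prod_le.
Qed.

Lemma strong_pow_split (G : sgraph) m n :
  cohom_le (strong_pow G (m + n)) (strong_prod (strong_pow G m) (strong_pow G n)).
Proof.
elim: m => [|m IHm]; first exact: strong_prod_unitl_ge.
apply: cohom_le_trans (strong_prod_assocl _ _ _).
exact: strong_prod_le (cohom_le_refl G) IHm.
Qed.

Lemma strong_pow_merge (G : sgraph) m n :
  cohom_le (strong_prod (strong_pow G m) (strong_pow G n)) (strong_pow G (m + n)).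
Proof.
elim: m => [|m IHm]; first exact: strong_prod_unitl.
apply: cohom_le_trans (strong_prod_assocr _ _ _) _.
exact: strong_prod_le (cohom_le_refl G) IHm.
Qed.

Lemma strong_powM_split (G : sgraph) m n :
  cohom_le (strong_pow G (n * m)) (strong_pow (strong_pow G m) n).
Proof.
elim: n => [|n IHn]; first exact: cohom_le_refl.
rewrite mulSn; apply: cohom_le_trans (strong_pow_split _ _ _) _.
exact: strong_prod_le (cohom_le_refl _) IHn.
Qed.

Lemma strong_powM_merge (G : sgraph) m n :
  cohom_le (strong_pow (strong_pow G m) n) (strong_pow G (n * m)).
Proof.
elim: n => [|n IHn]; first exact: cohom_le_refl.
rewrite mulSn; apply: cohom_le_trans (strong_pow_merge _ _ _).
exact: strong_prod_le (cohom_le_refl _) IHn.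
Qed.

Lemma strong_pow_prod (G H : sgraph) n :
  cohom_le (strong_pow (strong_prod G H) n)
           (strong_prod (strong_pow G n) (strong_pow H n)).
Proof.
elim: n => [|n IHn]; first exact: strong_prod_unitl_ge.
apply: cohom_le_trans (strong_prod_interchange _ _ _ _).
exact: strong_prod_le (cohom_le_refl _) IHn.
Qed.

Lemma card_strong_pow (G : sgraph) n : #|strong_pow G n| = (#|G| ^ n)%N.
Proof. by elim: n => [|n IHn]; rewrite ?card_ord // card_prod IHn expnS. Qed.

(** * The independence number *)

Lemma independent_card_le (G H : sgraph) (A : {set G}) (f : G -> H) :
  independent A -> cohom_on (mem A) f -> (#|A| <= alpha H)%N.
Proof.
move=> /forall_inP indA fP.
have sep u v : u \in A -> v \in A -> u != v -> apart (f u) (f v).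
  move=> uA vA uv; apply: fP => //; rewrite /apart uv /=.
  by have /forall_inP := indA u uA; exact.
have injf : {in A &, injective f}.
  move=> u v uA vA fuv; apply/eqP/negPn/negP => uv.
  by have /andP[] := sep u v uA vA uv; rewrite fuv eqxx.
rewrite -(card_in_imset injf).
apply: (@leq_bigmax_cond _ (@independent H) (fun B => #|B|)).
apply/forall_inP => _ /imsetP[u uA ->]; apply/forall_inP => _ /imsetP[v vA ->].
have [->|uv] := eqVneq u v; first by rewrite adj_irrefl.
by have /andP[] := sep u v uA vA uv.
Qed.

Lemma independent_alpha (G : sgraph) :
  exists2 A : {set G}, independent A & alpha G = #|A|.
Proof.
have ind0 : independent (finset.set0 : {set G}).
  by apply/forall_inP => u; rewrite inE.
have [|A indA maxA] := @eq_bigmax_cond _ (@independent G) (fun B => #|B|).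
  by apply/card_gt0P; exists finset.set0.
by exists A; [exact: indA|exact: maxA].
Qed.

Lemma alpha_le (G H : sgraph) : cohom_le G H -> (alpha G <= alpha H)%N.
Proof.
move=> /cohom_leP[f fP]; have [A indA ->] := independent_alpha G.
by apply: (independent_card_le indA (f := f)) => u v _ _; exact: fP.
Qed.

Lemma alpha_le_card (G : sgraph) : (alpha G <= #|G|)%N.
Proof. by have [A _ ->] := independent_alpha G; exact: max_card. Qed.

Lemma alpha_gt0 (G : sgraph) : (0 < #|G|)%N -> (0 < alpha G)%N.
Proof.
move=> /card_gt0P[x _]; rewrite -(cards1 x).
apply: (@leq_bigmax_cond _ (@independent G) (fun B => #|B|)).
apply/forall_inP => u /set1P ->; apply/forall_inP => v /set1P ->.
by rewrite adj_irrefl.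
Qed.

Lemma alpha_prod_ge (G H : sgraph) :
  (alpha G * alpha H <= alpha (strong_prod G H))%N.
Proof.
have [A indA ->] := independent_alpha G; have [B indB ->] := independent_alpha H.
rewrite -cardsX.
apply: (@leq_bigmax_cond _ (@independent (strong_prod G H)) (fun C => #|C|)).
apply/forall_inP => -[a x] /setXP[/= aA xB].
apply/forall_inP => -[b y] /setXP[/= bA yB].
have /forall_inP/(_ _ bA) nab := forall_inP indA a aA.
have /forall_inP/(_ _ yB) nxy := forall_inP indB x xB.
rewrite /= /strong_adj /= xpair_eqE (negPf nab) (negPf nxy) !orbF.
by case: eqP; case: eqP.
Qed.

(** The fibre of an independent set over a vertex of [G] is independent in [H]. *)
Lemma alpha_prod_le (G H : sgraph) :
  (alpha (strong_prod G H) <= #|G| * alpha H)%N.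
Proof.
have [A indA ->] := independent_alpha (strong_prod G H).
rewrite -sum_nat_const -sum1_card (partition_big fst predT) //=.
apply: leq_sum => a _.
rewrite (_ : \sum_(i in A | i.1 == a) 1 = #|[set u in A | u.1 == a]|)%N; last first.
  by rewrite -sum1_card; apply: eq_bigl => u; rewrite inE.
apply: (@independent_card_le (strong_prod G H) _ _ snd).
  apply/forall_inP => u; rewrite inE => /andP[uA _].
  apply/forall_inP => v; rewrite inE => /andP[vA _].
  by have /forall_inP := forall_inP indA u uA; exact.
move=> u v; rewrite !inE => /andP[_ /eqP ua] /andP[_ /eqP va].
by rewrite apart_prod ua va /apart eqxx.
Qed.

(** * Covering a power by few powers of a smaller graph *)

Fixpoint coords (G : sgraph) n : strong_pow G n -> seq G :=
  if n is n'.+1 then fun u => u.1 :: coords u.2 else fun=> [::].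

Fixpoint pow_map (G H : sgraph) (f : G -> H) n :
    strong_pow G n -> strong_pow H n :=
  if n is n'.+1 then fun u => (f u.1, pow_map f u.2) else id.

Lemma size_coords (G : sgraph) n (u : strong_pow G n) : size (coords u) = n.
Proof. by elim: n u => //= n IHn u; rewrite IHn. Qed.

Lemma pow_map_cohom (G H : sgraph) (P : {pred G}) (f : G -> H) n :
  cohom_on P f -> cohom_on [pred u | all (mem P) (coords u)] (@pow_map G H f n).
Proof.
move=> fP; elim: n => [|n IHn] u v.
  by rewrite (ord1 u) (ord1 v) /apart eqxx.
rewrite !inE => /= /andP[u1 u2] /andP[v1 v2].
by rewrite !apart_prod => /orP[/fP|/IHn] -> //; rewrite ?inE ?orbT.
Qed.

(** A vertex of the [n]-th power has only [n] coordinates, so some [z i] is not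
    among them, and that [i] labels a copy of the power of [H] in which the
    vertex is placed. *)
Lemma strong_pow_cover (G H : sgraph) n (z : 'I_n.+1 -> G)
    (g : 'I_n.+1 -> G -> H) :
  injective z -> (forall i, cohom_on [pred u | u != z i] (g i)) ->
  cohom_le (strong_pow G n) (strong_prod (edgeless n.+1) (strong_pow H n)).
Proof.
move=> injz gP.
have miss (u : strong_pow G n) : exists i, z i \notin coords u.
  apply/existsP; apply: contraT; rewrite negb_exists => /forallP zu.
  have := @uniq_leq_size _ (codom z) (coords u).
  rewrite size_codom card_ord size_coords ltnn => -> //.
    by apply/injectiveP.
  by move=> _ /codomP[i ->]; rewrite -[_ \in _]negbK zu.
pose label u := xchoose (miss u).
apply: (@cohom_le_of (strong_pow G n) (strong_prod (edgeless n.+1) (strong_pow H n))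
  (fun u => (label u, pow_map (g (label u)) u))) => u v uv.
rewrite apart_prod apart_edgeless /=.
have [luv|//] := eqVneq (label u) (label v).
have inP (w : strong_pow G n) :
    w \in [pred w | all (mem [pred t | t != z (label w)]) (coords w)].
  rewrite inE; apply/allP => t tw; rewrite !inE.
  by apply: contraNneq (xchooseP (miss w)) => <-.
have := pow_map_cohom (gP (label u)) (inP u); rewrite luv; apply => //.
exact: inP.
Qed.

(** * Maps between fraction graphs *)

Lemma modn_diff p u v : (u < p)%N -> (v < p)%N ->
  ((u + (p - v)) %% p)%N = (if v <= u then u - v else u + p - v)%N.
Proof.
move=> up vp; case: leqP => uv.
  by rewrite addnBA ?(ltnW vp) // addnC -addnBA // modnDl modn_small; lia.
by rewrite modn_small; lia.
Qed.

Lemma apart_frac p q (u v : fraction_graph p q) : (v < u)%N ->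
  apart u v = (q <= u - v)%N && (u - v + q <= p)%N.
Proof.
move=> vu; have up := ltn_ord u; have vp := ltn_ord v.
have uv : u != v by apply: contraTneq vu => ->; rewrite ltnn.
rewrite /apart uv /= /frac_adj uv /= !modn_diff //.
by rewrite (ltnW vu) [(u <= v)%N]leqNgt vu /= negb_or -!leqNgt; congr (_ && _); lia.
Qed.

Lemma scale_subproof (p a : nat) (u : 'I_p) : (0 < a)%N -> (u * a %/ p < a)%N.
Proof.
move=> a0; have up := ltn_ord u.
by rewrite ltn_divLR; [rewrite mulnC ltn_pmul2l|exact: leq_ltn_trans up].
Qed.

Definition scale p q a b (a0 : (0 < a)%N) (u : fraction_graph p q) :
  fraction_graph a b := Ordinal (scale_subproof u a0).

(** If [u - v] is at least [q] then [u * a / p] and [v * a / p] differ by at least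
    [b - e / p]. Residues in the range from [e] to [p - 1] differ by less than
    [p - e], so after rounding down the difference still exceeds [b - 1], and it
    is an integer. The upper bound is the same argument on the other arc of the
    cycle. *)
Lemma scale_cohom p q a b e (a0 : (0 < a)%N) : (0 < b)%N ->
  (p * b <= q * a + e)%N ->
  cohom_on [pred u : fraction_graph p q | (e <= u * a %% p)%N] (@scale p q a b a0).
Proof.
move=> b0 le_e u v; rewrite !inE.
wlog vu : u v / (v < u)%N => [hw|].
  have [uv|uv|/val_inj ->] := ltngtP (u : nat) v; last by rewrite /apart eqxx.
  - by move=> ue ve; rewrite apart_sym [in X in _ -> X]apart_sym; exact: hw.
  - exact: hw.
move=> ue ve; rewrite apart_frac // => /andP[qd dq].
have p0 : (0 < p)%N by case: (p) (u) => [[]|].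
have ru := ltn_pmod (u * a) p0; have rv := ltn_pmod (v * a) p0.
have Eu := divn_eq (u * a) p; have Ev := divn_eq (v * a) p.
have vk : (v * a %/ p + b <= u * a %/ p)%N.
  move: ue ve ru rv Eu Ev; set k' := (_ %/ _)%N; set k := (_ %/ _)%N.
  move: (_ %% _)%N (_ %% _)%N => r' r ue ve ru rv Eu Ev.
  rewrite leqNgt; apply/negP => kb.
  have h1 : (v * a + q * a <= u * a)%N by rewrite -mulnDl leq_mul2r; lia.
  have h2 : (k'.+1 * p <= (k + b) * p)%N by rewrite leq_mul2r kb orbT.
  lia.
have uk : (u * a %/ p + b <= v * a %/ p + a)%N.
  move: ue ve ru rv Eu Ev; set k' := (_ %/ _)%N; set k := (_ %/ _)%N.
  move: (_ %% _)%N (_ %% _)%N => r' r ue ve ru rv Eu Ev.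
  rewrite leqNgt; apply/negP => kb.
  have h1 : (u * a + q * a <= v * a + p * a)%N.
    by rewrite -!mulnDl leq_mul2r; lia.
  have h2 : ((k + a).+1 * p <= (k' + b) * p)%N by rewrite leq_mul2r kb orbT.
  lia.
rewrite apart_frac /=; last by lia.
by apply/andP; split; lia.
Qed.

Lemma fraction_graph_le p q a b : (0 < a)%N -> (0 < b)%N ->
  (p * b <= q * a)%N -> cohom_le (fraction_graph p q) (fraction_graph a b).
Proof.
move=> a0 b0 le_pq; apply: (@cohom_le_of _ _ (@scale p q a b a0)) => u v.
by apply: (@scale_cohom p q a b 0); rewrite ?addn0 ?inE.
Qed.

Lemma rotate_subproof p (c u : 'I_p) : ((u + (p - c)) %% p < p)%N.
Proof. by rewrite ltn_pmod //; exact: leq_ltn_trans (ltn_ord u). Qed.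

Definition rotate p q (c u : fraction_graph p q) : fraction_graph p q :=
  Ordinal (rotate_subproof c u).

Lemma rotate_apart p q (c u v : fraction_graph p q) :
  apart u v -> apart (rotate c u) (rotate c v).
Proof.
wlog vu : u v / (v < u)%N => [hw|].
  have [uv|uv|/val_inj ->] := ltngtP (u : nat) v; last by rewrite /apart eqxx.
  - by rewrite apart_sym [in X in _ -> X]apart_sym; exact: hw.
  - exact: hw.
have up := ltn_ord u; have vp := ltn_ord v; have cp := ltn_ord c.
rewrite apart_frac //.
have Eu : rotate c u = (if c <= u then u - c else u + p - c)%N :> nat.
  exact: modn_diff.
have Ev : rotate c v = (if c <= v then v - c else v + p - c)%N :> nat.
  exact: modn_diff.
have [ruv|rvu] := ltnP (rotate c v) (rotate c u).
  rewrite apart_frac // => /andP[h1 h2]; apply/andP; move: ruv; rewrite Eu Ev.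
  by case: (leqP c u) => ?; case: (leqP c v) => ?; lia.
rewrite apart_sym => /andP[h1 h2]; rewrite apart_frac; move: rvu; rewrite Eu Ev.
  by case: (leqP c u) => ?; case: (leqP c v) => ?; lia.
by case: (leqP c u) => ?; case: (leqP c v) => ?; lia.
Qed.

(** When [p * b = q * a + 1] the numbers [p] and [a] are coprime, so [0] is the
    only vertex whose residue leaves no room for the defect [1]; a rotation
    moves it to any prescribed [c]. *)
Lemma scale_rotate_cohom p q a b (a0 : (0 < a)%N) (c : fraction_graph p q) :
  (0 < b)%N -> (p * b)%N = (q * a).+1 ->
  cohom_on [pred u | u != c] (@scale p q a b a0 \o rotate c).
Proof.
move=> b0 pb u v uc vc uv.
have co_pa : coprime p a.
  apply/coprimeP; last by exists (b, q); rewrite /= mulnC pb subSnn.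
  exact: leq_ltn_trans (ltn_ord c).
have room (w : fraction_graph p q) : w != c -> (1 <= rotate c w * a %% p)%N.
  move=> wc; rewrite lt0n -/(dvdn p _) Gauss_dvdl //.
  have wp := ltn_ord w; have cp := ltn_ord c.
  rewrite /dvdn modn_small ?ltn_ord //= modn_diff //.
  have : (w : nat) != c by [].
  by case: (leqP c w) => ?; lia.
apply: (@scale_cohom p q a b 1); rewrite ?inE ?room ?addn1 ?pb //.
exact: rotate_apart.
Qed.

(** The omitted vertices are [0], ..., [n], each with its own rotation; this is
    why [p] has to exceed [n]. *)
Lemma fraction_pow_cover p q a b n : (0 < a)%N -> (0 < b)%N -> (n < p)%N ->
  (p * b)%N = (q * a).+1 ->
  cohom_le (strong_pow (fraction_graph p q) n)
           (strong_prod (edgeless n.+1) (strong_pow (fraction_graph a b) n)).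
Proof.
move=> a0 b0 np pb.
apply: (@strong_pow_cover _ _ _ (widen_ord np : _ -> fraction_graph p q)
  (fun i => @scale p q a b a0 \o rotate (widen_ord np i))) => [i j [ij]|i].
  exact: val_inj.
exact: scale_rotate_cohom.
Qed.

(** Vertices [0] and [1] are adjacent as soon as [1 < q], so a maximum independent
    set already omits a vertex. *)
Lemma fraction_alpha_le p q a b : (0 < a)%N -> (0 < b)%N -> (1 < p)%N ->
  (1 < q)%N -> (p * b)%N = (q * a).+1 ->
  (alpha (fraction_graph p q) <= alpha (fraction_graph a b))%N.
Proof.
move=> a0 b0 p1 q1 pb.
have [A indA ->] := independent_alpha (fraction_graph p q).
have [c cA] : exists c, c \notin A.
  pose x0 : fraction_graph p q := Ordinal (ltnW p1).
  pose x1 : fraction_graph p q := Ordinal p1.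
  have [x0A|] := boolP (x0 \in A); last by exists x0.
  exists x1; apply/negP => x1A.
  have /forall_inP/(_ x0 x0A) := forall_inP indA x1 x1A.
  have : ~~ apart x1 x0 by rewrite apart_frac //= subn0 leqNgt q1.
  by move=> /nandP[|/negPn ->].
apply: (independent_card_le indA (f := @scale p q a b a0 \o rotate c)) => u v uA vA.
by apply: scale_rotate_cohom => //; rewrite inE; apply: contraNneq cA => <-.
Qed.

(** * Growth rates of supermultiplicative sequences *)

Lemma cvg_root (R : realType) (x : R) :
  0 < x -> x `^ n%:R^-1 @[n --> \oo] --> (1 : R).
Proof.
move=> x0; rewrite -cvg_shiftS.
have -> : [sequence x `^ n.+1%:R^-1]_n = (fun n => expR (harmonic n * ln x)).
  by apply/funext => n /=; rewrite /powR gt_eqF.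
have hln : harmonic n * ln x @[n --> \oo] --> (0 : R).
  by rewrite -(mul0r (ln x)); apply: cvgMl; exact: cvg_harmonic.
have := continuous_cvg _ (@continuous_expR R 0) hln.
by rewrite expR0; apply.
Qed.

Lemma root_ge1 (R : realType) (x r : R) : 1 <= x -> 0 <= r -> 1 <= x `^ r.
Proof. by move=> x1 r0; rewrite -(powRr0 x) ler_powR. Qed.

Lemma root_exp (R : realType) (x : R) n : 0 <= x -> (0 < n)%N ->
  (x `^ n%:R^-1) ^+ n = x.
Proof.
move=> x0 n0; rewrite -powR_mulrn ?powR_ge0 // -powRrM mulVf ?powRr1 //.
by rewrite pnatr_eq0 -lt0n.
Qed.

(** Fekete's lemma in multiplicative form. *)
Section Fekete.
Variables (R : realType) (u : nat -> R) (C : R).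
Hypothesis u_ge1 : forall n, 1 <= u n.
Hypothesis u_supermul : forall m n, u m * u n <= u (m + n)%N.
Hypothesis u_le : forall n, u n <= C ^+ n.

Let v n := u n `^ n%:R^-1.

Let u_ge0 n : 0 <= u n. Proof. exact: le_trans (u_ge1 n). Qed.

Lemma supermul_exp m k : u m ^+ k <= u (k * m)%N.
Proof.
elim: k => [|k IHk]; first exact: u_ge1.
rewrite exprS mulSn; apply: le_trans (u_supermul _ _).
exact: ler_wpM2l.
Qed.

Lemma supermul_mono m n : u m <= u (m + n)%N.
Proof. by apply: le_trans (u_supermul _ _); rewrite ler_peMr. Qed.

Lemma supermul_root_le n : v n <= Num.max 1 C.
Proof.
have [->|n0] := posnP n; first by rewrite /v invr0 powRr0 le_max lexx.
rewrite leNgt; apply/negP; rewrite gt_max => /andP[v1 vC].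
have C0 : 0 <= C by have := le_trans (u_ge1 1) (u_le 1); rewrite expr1; lra.
have : C ^+ n < v n ^+ n by rewrite ltrXn2r // -lt0n.
by rewrite root_exp // ltNge u_le.
Qed.

(** Writing [n = k * m + r] with [r < m], the loss of [v n] against [v m] is at
    most the root of one block [u m]. *)
Lemma supermul_root m n : (0 < n)%N -> v m <= v n * u m `^ n%:R^-1.
Proof.
move=> n0; have [->|m0] := posnP m.
  by rewrite [v 0]/v invr0 powRr0 mulr_ege1 // root_ge1.
have u_block : u m ^+ (n %/ m).+1 <= u n * u m.
  rewrite exprSr ler_wpM2r //; apply: le_trans (supermul_exp _ _) _.
  by rewrite [X in _ <= u X](divn_eq n m) supermul_mono.
apply: (@le_trans _ _ ((u m ^+ (n %/ m).+1) `^ n%:R^-1)).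
  rewrite -powR_mulrn // -powRrM ler_powR //.
  rewrite ler_pdivlMr ?ltr0n // mulrC ler_pdivrMr ?ltr0n // -natrM ler_nat.
  by rewrite ltnW // ltn_ceil.
by rewrite -powRM // ge0_ler_powR ?nnegrE ?invr_ge0 ?exprn_ge0 ?mulr_ge0.
Qed.

Lemma supermul_has_sup : has_sup (range v).
Proof.
split; first by exists (v 0), 0%N.
by exists (Num.max 1 C) => _ [n _ <-]; exact: supermul_root_le.
Qed.

Lemma supermul_root_le_sup n : v n <= sup (range v).
Proof. by apply: ub_le_sup; [exact: supermul_has_sup.2|exists n]. Qed.

Lemma supermul_root_cvg : v n @[n --> \oo] --> sup (range v).
Proof.
set s := sup _; have s1 : 1 <= s.
  by apply: le_trans (supermul_root_le_sup 0); rewrite /v invr0 powRr0.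
apply/cvgrPdist_lt => e e0.
have e2 : 0 < e / 2 by rewrite divr_gt0.
have [_ [m _ <-] vm] := sup_adherent e2 supermul_has_sup.
have um0 : 0 < u m by exact: lt_le_trans (u_ge1 m).
have := cvg_root um0; move/cvgrPdist_lt => /(_ (e / 2 / s)).
rewrite divr_gt0 //; last exact: lt_le_trans s1.
move=> /(_ isT); apply: filterS2 (nbhs_infty_gt 0) => n n0.
set c := _ `^ _ => hc.
have vs : v n <= s := supermul_root_le_sup n.
rewrite ger0_norm ?subr_ge0 //.
have := supermul_root m n0; rewrite -/c => vmn.
have c1 : 1 <= c by rewrite root_ge1.
have v0 : 0 <= v n by exact: powR_ge0.
have : s * (c - 1) < e / 2.
  move: hc; rewrite distrC ger0_norm ?subr_ge0 // ltr_pdivlMr 1?mulrC //.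
  exact: lt_le_trans s1.
have : v n * (c - 1) <= s * (c - 1) by rewrite ler_wpM2r // subr_ge0.
by rewrite -/s in vm; lra.
Qed.

End Fekete.

(** * The Shannon capacity *)

Section Capacity.
Variables (R : realType) (G : sgraph).
Hypothesis G_gt0 : (0 < #|G|)%N.

Let u n : R := independence_number R (strong_pow G n).

Let u_ge1 n : 1 <= u n.
Proof.
by rewrite /u /independence_number ler1n alpha_gt0 // card_strong_pow expn_gt0 G_gt0.
Qed.

Let u_ge0 n : 0 <= u n. Proof. exact: ler0n. Qed.

Let u_supermul m n : u m * u n <= u (m + n)%N.
Proof.
rewrite /u /independence_number -natrM ler_nat.
exact: leq_trans (alpha_prod_ge _ _) (alpha_le (strong_pow_merge G m n)).
Qed.

Let u_le n : u n <= #|G|%:R ^+ n.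
Proof.
by rewrite /u /independence_number -natrX -card_strong_pow ler_nat alpha_le_card.
Qed.

Lemma shannon_capacity_cvg :
  u n `^ n%:R^-1 @[n --> \oo] --> shannon_capacity R G.
Proof.
have := supermul_root_cvg u_ge1 u_supermul u_le; rewrite /shannon_capacity => h.
by rewrite (cvg_lim _ h).
Qed.

Lemma shannon_capacity_ge0 : 0 <= shannon_capacity R G.
Proof.
by apply: (limr_ge (cvgP _ shannon_capacity_cvg)); apply: nearW => n; exact: powR_ge0.
Qed.

Lemma independence_number_le_capacity n :
  independence_number R (strong_pow G n) <= shannon_capacity R G ^+ n.
Proof.
have [->|n0] := posnP n.
  rewrite expr0 /independence_number lern1; apply: leq_trans (alpha_le_card _) _.
  by rewrite card_ord.
rewrite -/(u n) -[leLHS](root_exp (u_ge0 n) n0).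
apply: lerXn2r; rewrite ?nnegrE ?powR_ge0 ?shannon_capacity_ge0 //.
have := supermul_root_le_sup u_ge1 u_le n.
have -> // : sup (range (fun n => u n `^ n%:R^-1)) = shannon_capacity R G.
apply: (cvg_unique _ (supermul_root_cvg u_ge1 u_supermul u_le)) => //.
exact: shannon_capacity_cvg.
Qed.

Lemma shannon_capacity_le (C : R) : 0 <= C ->
  (forall n, independence_number R (strong_pow G n) <= C ^+ n) ->
  shannon_capacity R G <= C.
Proof.
move=> C0 uC; apply: (limr_le (cvgP _ shannon_capacity_cvg)).
near=> n; have n0 : (0 < n)%N by near: n; exact: nbhs_infty_gt.
rewrite leNgt; apply/negP => Cv.
have : C ^+ n < (u n `^ n%:R^-1) ^+ n by rewrite ltrXn2r // -lt0n.
rewrite root_exp //.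
by rewrite ltNge uC.
Unshelve. all: by end_near. Qed.

End Capacity.

(** * Graph parameters that control powers *)

Section GraphParameters.
Variable R : realType.
Implicit Type F : sgraph -> R.

(** What remains of multiplicativity once only powers of a single graph are
    compared; the Shannon capacity, which is not multiplicative, still has this
    property. *)
Definition power_monotone F : Prop := forall (G H : sgraph) m N,
  (0 < m)%N -> (0 < #|G|)%N ->
  cohom_le (strong_pow G m) (strong_prod (edgeless N) (strong_pow H m)) ->
  F G ^+ m <= N%:R * F H ^+ m.

Lemma spectral_pow F G n :
  asymptotic_spectrum F -> F (strong_pow G n) = F G ^+ n.
Proof.
move=> FX; elim: n => [|n IHn]; first exact: (spectral_edgeless FX 1).
by rewrite exprS -IHn -(spectral_prod FX).
Qed.

Lemma spectral_power_monotone F : asymptotic_spectrum F -> power_monotone F.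
Proof.
move=> FX G H m N _ _ /(spectral_le FX).
by rewrite (spectral_prod FX) (spectral_edgeless FX) !spectral_pow.
Qed.

(** The [n]-th power of the hypothesis bounds the independence number of
    [G^(n * m)] by [N ^ n] times that of [H^(n * m)]. Supermultiplicativity
    compares the former with the [m]-th power of the independence number of
    [G^n]. *)
Lemma shannon_power_monotone : power_monotone (@shannon_capacity R).
Proof.
move=> G H m N m0 G0 GH.
have pow_le n : (alpha (strong_pow G (n * m)) <=
    N ^ n * alpha (strong_pow H (n * m)))%N.
  have -> : (N ^ n)%N = #|strong_pow (edgeless N) n|.
    by rewrite card_strong_pow card_ord.
  apply: leq_trans (leq_mul (leqnn _) (alpha_le (strong_powM_merge H m n))).
  apply: leq_trans (alpha_prod_le _ _).
  apply: alpha_le; apply: cohom_le_trans (strong_powM_split G m n) _.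
  apply: cohom_le_trans (strong_pow_le n GH) _.
  exact: strong_pow_prod.
have [N0 H0] : (0 < N)%N /\ (0 < #|H|)%N.
  have /alpha_gt0 a0 : (0 < #|strong_pow G m|)%N.
    by rewrite card_strong_pow expn_gt0 G0.
  have := leq_trans a0 (leq_trans (alpha_le GH) (alpha_le_card _)).
  rewrite card_prod card_ord card_strong_pow muln_gt0 expn_gt0 => /andP[-> /orP[//|]].
  by rewrite eqn0Ngt m0.
set T := shannon_capacity R H.
have T0 : 0 <= T by exact: shannon_capacity_ge0.
have B0 : 0 <= N%:R `^ m%:R^-1 * T by rewrite mulr_ge0 ?powR_ge0.
have : shannon_capacity R G <= N%:R `^ m%:R^-1 * T.
  apply: shannon_capacity_le => // n.
  have nn0 K : 0 <= independence_number R K by exact: ler0n.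
  rewrite -(@ler_pXn2r _ m) // ?nnegrE ?exprn_ge0 //.
  rewrite exprAC exprMn root_exp ?ler0n // exprMn -exprM mulnC.
  apply: (@le_trans _ _ (independence_number R (strong_pow G (n * m)))).
    rewrite /independence_number -natrX ler_nat.
    elim: (m) => [|k IHk].
      by rewrite muln0 expn0 alpha_gt0 // card_ord.
    rewrite expnS mulnS; apply: leq_trans (alpha_le (strong_pow_merge _ _ _)).
    by apply: leq_trans (alpha_prod_ge _ _); rewrite leq_mul2l IHk orbT.
  apply: (@le_trans _ _ ((N ^ n * alpha (strong_pow H (n * m)))%N%:R)).
    by rewrite ler_nat.
  rewrite natrM natrX ler_wpM2l ?exprn_ge0 //.
  exact: independence_number_le_capacity.
move=> /(lerXn2r m); rewrite !nnegrE B0 shannon_capacity_ge0 // => /(_ isT isT).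
by rewrite exprMn root_exp.
Qed.

Lemma power_monotone_le F (G H : sgraph) :
  power_monotone F -> (0 < #|G|)%N -> cohom_le G H -> F G <= F H.
Proof.
move=> FP G0 GH; have := FP G H 1%N 1%N isT G0; rewrite !expr1 mul1r; apply.
exact: cohom_le_trans (strong_pow_le 1 GH) (strong_prod_unitl_ge _).
Qed.

Definition graph_parameter F : Prop :=
  [\/ asymptotic_spectrum F, F = @independence_number R
    | F = @shannon_capacity R].

Lemma graph_parameter_le F (G H : sgraph) :
  graph_parameter F -> (0 < #|G|)%N -> cohom_le G H -> F G <= F H.
Proof.
case=> [FX|->|->] G0 GH.
- exact: (spectral_le FX GH).
- by rewrite /independence_number ler_nat alpha_le.
- exact: (power_monotone_le shannon_power_monotone).
Qed.

Lemma shannon_capacity_le_card (G : sgraph) :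
  (0 < #|G|)%N -> shannon_capacity R G <= #|G|%:R.
Proof.
move=> G0; apply: shannon_capacity_le => // n.
by rewrite /independence_number -natrX -card_strong_pow ler_nat alpha_le_card.
Qed.

Lemma bernoulli_ineq (t : R) n : 0 <= t -> 1 + t *+ n <= (1 + t) ^+ n.
Proof.
move=> t0; elim: n => [|n IHn]; first by rewrite mulr0n addr0 expr0.
rewrite exprS; apply: le_trans (_ : (1 + t) * (1 + t *+ n) <= _).
  have tn : 0 <= t * (t *+ n) by rewrite mulr_ge0 ?mulrn_wge0.
  by rewrite mulrS; lra.
by rewrite ler_wpM2l // addr_ge0.
Qed.

(** The [m]-th root of [m + 1] tends to [1], so on a bounded range a factor
    [m + 1] between [m]-th powers costs at most [e], uniformly. *)
Lemma power_gap (a e : R) : 0 < a -> 0 < e ->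
  exists2 m, (0 < m)%N & forall x y : R, 0 <= x <= a -> 0 <= y ->
    y ^+ m <= m.+1%:R * x ^+ m -> y < x + e.
Proof.
move=> a0 e0.
have [t t0 tE] : exists2 t, 0 < t & t = e / a by exists (e / a); rewrite ?divr_gt0.
have t_ge0 := ltW t0.
have [k k0 kt] : exists2 k, (0 < k)%N & 3 < k%:R * t ^+ 2.
  exists (Num.bound (3 / t ^+ 2)).
    rewrite -(ltr0n R); apply: lt_trans (archi_boundP _); last first.
      by rewrite divr_ge0 ?exprn_ge0 ?ltW.
    by rewrite divr_gt0 ?exprn_gt0.
  by rewrite -ltr_pdivrMr ?exprn_gt0 // archi_boundP // divr_ge0 ?exprn_ge0 ?ltW.
(* Bernoulli is applied to each half of the exponent, to grow faster than [m] *)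
have big : (k * 2).+1%:R < (1 + t) ^+ (k * 2).
  have k1 : 1 <= k%:R :> R by rewrite ler1n.
  have b0 : k%:R * t <= (1 + t) ^+ k.
    by apply: le_trans _ (bernoulli_ineq _ t_ge0); rewrite mulr_natl lerDr.
  rewrite exprM; apply: lt_le_trans (_ : (k%:R * t) ^+ 2 <= _); last first.
    by apply: lerXn2r => //; rewrite nnegrE ?exprn_ge0 ?mulr_ge0 ?addr_ge0.
  rewrite exprMn expr2 -mulrA -natr1 natrM.
  have : k%:R * 3 < k%:R * (k%:R * t ^+ 2) by rewrite ltr_pM2l // ltr0n.
  lra.
exists (k * 2)%N; first by rewrite muln_gt0 k0.
move=> x y /andP[x0 xa] y0 ym; rewrite ltNge; apply/negP => xy.
have xte : x * (1 + t) <= y.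
  apply: le_trans xy; rewrite mulrDr mulr1 lerD2l tE mulrCA ger_pMr //.
  by rewrite ler_pdivrMr ?mul1r.
move: x0; rewrite le_eqVlt => /orP[/eqP x0|x0].
  move: ym; rewrite -x0 expr0n muln_eq0 eqn0Ngt k0 /= mulr0 leNgt exprn_gt0 //.
  by apply: lt_le_trans xy; rewrite -x0 add0r.
have x_ge0 := ltW x0.
have : (x * (1 + t)) ^+ (k * 2) <= (k * 2).+1%:R * x ^+ (k * 2).
  by apply: le_trans ym; apply: lerXn2r; rewrite ?nnegrE ?mulr_ge0 ?addr_ge0.
by rewrite exprMn mulrC ler_pM2r ?exprn_gt0 // leNgt big.
Qed.

(** * Approximation from above *)

(** The fractions [p/q = (p0 + n * a) / (q0 + n * b)] with [p0 * b - q0 * a = 1]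
    decrease to [a/b], and each of them exceeds [a/b] by the minimal amount that
    its denominator allows. *)
Lemma upper_neighbour a b n : (0 < a)%N -> (0 < b)%N -> coprime a b ->
  exists p q, [/\ (n < p)%N, (n < q)%N & (p * b)%N = (q * a).+1].
Proof.
move=> a0 b0; rewrite coprime_sym => /coprimeP -/(_ b0)[[p0 q0] /= pq0].
exists (p0 + n.+1 * a)%N, (q0 + n.+1 * b)%N.
have na : (n.+1 <= n.+1 * a)%N by rewrite leq_pmulr.
have nb : (n.+1 <= n.+1 * b)%N by rewrite leq_pmulr.
by split; lia.
Qed.

(** The exponent [m] is chosen first, from [a] and [e] alone; the numerator of
    [p/q] is then taken large enough to provide [m + 1] vertices. *)
Lemma approx_above a b (e : R) : (0 < a)%N -> (0 < b)%N -> coprime a b -> 0 < e ->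
  exists p q, [/\ (0 < p)%N, (0 < q)%N, (q * a < p * b)%N &
    forall F, graph_parameter F ->
      F (fraction_graph p q) < F (fraction_graph a b) + e].
Proof.
move=> a0 b0 co_ab e0.
have [|m m0 gap] := @power_gap a%:R e _ e0; first by rewrite ltr0n.
have [p [q [mp mq pb]]] := upper_neighbour m a0 b0 co_ab.
have p0 : (0 < p)%N by exact: leq_ltn_trans mp.
have Gp : (0 < #|fraction_graph p q|)%N by rewrite card_ord.
have Ga : (0 < #|fraction_graph a b|)%N by rewrite card_ord.
exists p, q; split=> //; [exact: leq_ltn_trans mq|by rewrite pb|].
have use_gap F : power_monotone F -> 0 <= F (fraction_graph p q) ->
    0 <= F (fraction_graph a b) <= a%:R ->
    F (fraction_graph p q) < F (fraction_graph a b) + e.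
  by move=> FP Fp Fa; apply: gap => //; apply: FP => //; exact: fraction_pow_cover.
move=> F [FX|->|->].
- apply: use_gap; first exact: spectral_power_monotone.
    exact: spectral_ge0.
  rewrite (spectral_ge0 FX); apply: le_trans (spectral_le_card _ FX) _.
  by rewrite card_ord.
- apply: (@le_lt_trans _ _ (independence_number R (fraction_graph a b))).
    by rewrite ler_nat fraction_alpha_le // (leq_trans _ mq, leq_trans _ mp).
  by rewrite ltrDl.
- apply: use_gap; first exact: shannon_power_monotone.
    exact: shannon_capacity_ge0.
  rewrite shannon_capacity_ge0 //; apply: le_trans (shannon_capacity_le_card Ga) _.
  by rewrite card_ord.
Qed.

Lemma fraction_parameter_le F p q a b : graph_parameter F ->
  (0 < p)%N -> (0 < a)%N -> (0 < b)%N -> (p * b <= q * a)%N ->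
  F (fraction_graph p q) <= F (fraction_graph a b).
Proof.
move=> FP p0 a0 b0 le_pq; apply: graph_parameter_le => //; first by rewrite card_ord.
exact: fraction_graph_le.
Qed.

(** The bound at [P/Q] extends to the whole interval from [a/b] to [P/Q] by
    monotonicity in the fraction. *)
Lemma uniform_right_continuity a b (e : R) : (0 < a)%N -> (0 < b)%N -> 0 < e ->
  exists P Q, [/\ (0 < P)%N, (0 < Q)%N, (Q * a < P * b)%N &
    forall F, graph_parameter F -> forall p q, (0 < p)%N -> (0 < q)%N ->
      (a * q <= b * p)%N -> (p * Q <= q * P)%N ->
      F (fraction_graph a b) <= F (fraction_graph p q)
        < F (fraction_graph a b) + e].
Proof.
move=> a0 b0 e0; pose g := gcdn a b.
have g0 : (0 < g)%N by rewrite gcdn_gt0 a0.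
have [Ea Eb] : a = (a %/ g * g)%N /\ b = (b %/ g * g)%N.
  by split; rewrite divnK ?dvdn_gcdl ?dvdn_gcdr.
have a'0 : (0 < a %/ g)%N by rewrite divn_gt0 // dvdn_leq ?dvdn_gcdl.
have b'0 : (0 < b %/ g)%N by rewrite divn_gt0 // dvdn_leq ?dvdn_gcdr.
have co : coprime (a %/ g) (b %/ g).
  by rewrite /coprime -(eqn_pmul2r g0) muln_gcdl -Ea -Eb mul1n.
have [P [Q [P0 Q0 lt_ab near_ab]]] := approx_above a'0 b'0 co e0.
exists P, Q; split=> //.
  by rewrite Ea Eb !mulnA ltn_pmul2r.
move=> F FP p q p0 q0 le_l le_u; apply/andP; split.
  exact: fraction_parameter_le.
apply: (@le_lt_trans _ _ (F (fraction_graph P Q))).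
  exact: fraction_parameter_le.
apply: lt_le_trans (near_ab F FP) _; rewrite lerD2r.
apply: fraction_parameter_le => //.
by rewrite {1}Eb [in X in (_ <= X)%N]Ea mulnA [(b %/ g * _)%N]mulnC mulnAC.
Qed.

End GraphParameters.

(** * Right-continuity *)

Lemma ler_frac (K : numFieldType) (a b p q : nat) : (0 < b)%N -> (0 < q)%N ->
  (a%:R / b%:R <= p%:R / q%:R :> K) = (a * q <= b * p)%N.
Proof.
move=> b0 q0; rewrite ler_pdivrMr ?ltr0n // mulrAC ler_pdivlMr ?ltr0n //.
by rewrite -!natrM ler_nat [(p * b)%N]mulnC.
Qed.

Lemma frac_ge2_gt0 p q : frac_ge2 p q -> (0 < p)%N /\ (0 < q)%N.
Proof. by case/and3P. Qed.

Lemma right_continuity_spectrum (R : realType) a b (e : R) :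
  frac_ge2 a b -> 0 < e ->
  exists2 d : R, 0 < d & forall F : sgraph -> R, asymptotic_spectrum F ->
    forall p q : nat, frac_ge2 p q ->
      a%:R / b%:R <= p%:R / q%:R :> R -> p%:R / q%:R < a%:R / b%:R + d :> R ->
      F (fraction_graph a b) <= F (fraction_graph p q) /\
      F (fraction_graph p q) < F (fraction_graph a b) + e.
Proof.
move=> /frac_ge2_gt0[a0 b0] e0.
have [P [Q [P0 Q0 lt_ab near_ab]]] := uniform_right_continuity a0 b0 e0.
exists (P%:R / Q%:R - a%:R / b%:R).
  by rewrite subr_gt0 ltNge ler_frac // -ltnNge.
move=> F FX p q /frac_ge2_gt0[p0 q0]; rewrite ler_frac // subrKC => le_l /ltW.
rewrite ler_frac // => le_u; apply/andP.
by apply: near_ab => //; exact: Or31.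
Qed.

Lemma rat_ge2_frac (x : rat) : 2 <= x ->
  x = `|numq x|%N%:R / `|denq x|%N%:R /\ frac_ge2 `|numq x|%N `|denq x|%N.
Proof.
move=> x2; have x0 : 0 < x by exact: lt_le_trans x2.
have Ex : x = `|numq x|%N%:R / `|denq x|%N%:R.
  rewrite -[LHS]divq_num_den.
  by rewrite -[numq x]gtz0_abs ?numq_gt0 // -[denq x]gtz0_abs ?denq_gt0.
split=> //; rewrite /frac_ge2 -Ex x2 andbT !absz_gt0 denq_neq0 numq_eq0.
by rewrite gt_eqF.
Qed.
Lemma fraction_parameter_eq (R : realType) (F : sgraph -> R) p q a b :
  graph_parameter F -> frac_ge2 p q -> frac_ge2 a b ->
  p%:R / q%:R = a%:R / b%:R :> rat ->
  F (fraction_graph p q) = F (fraction_graph a b).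
Proof.
move=> FP /frac_ge2_gt0[p0 q0] /frac_ge2_gt0[a0 b0] /eqP.
rewrite eq_le !ler_frac // => /andP[le1 le2]; apply/eqP.
by rewrite eq_le !fraction_parameter_le // mulnC // [leqRHS]mulnC.
Qed.

Lemma right_continuous_parameter (R : realType) (F : sgraph -> R) :
  graph_parameter F -> exists f : rat -> R,
    (forall p q : nat, frac_ge2 p q ->
       f (p%:R / q%:R) = F (fraction_graph p q)) /\
    right_continuous_ge2 f.
Proof.
move=> FP; exists (fun y => F (fraction_graph `|numq y|%N `|denq y|%N)); split.
  move=> p q pq; have /rat_ge2_frac[Ex x2] : 2 <= p%:R / q%:R :> rat.
    by case/and3P: pq.
  by apply: fraction_parameter_eq; rewrite -?Ex.
move=> x x2; have [Ex /frac_ge2_gt0[]] := rat_ge2_frac x2.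
set a := `|numq x|%N in Ex *; set b := `|denq x|%N in Ex * => a0 b0.
apply/cvgrPdist_lt => e e0.
have [P [Q [P0 Q0 lt_ab near_ab]]] := uniform_right_continuity a0 b0 e0.
rewrite near_withinE; apply/nbhs_ballP; exists (P%:R / Q%:R - x) => /=.
  by rewrite subr_gt0 Ex ltNge ler_frac // -ltnNge.
move=> y; rewrite /ball /= => xy le_xy.
have [Ey /frac_ge2_gt0[c0 d0]] := rat_ge2_frac (le_trans x2 le_xy).
move: xy; rewrite ler0_norm ?subr_le0 // opprB ltrD2r => /ltW.
rewrite [X in X <= _]Ey ler_frac // => le_u.
move: le_xy; rewrite [X in X <= _]Ex [X in _ <= X]Ey ler_frac // => le_l.
have /andP[F1 F2] := near_ab F FP _ _ c0 d0 le_l le_u.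
by rewrite ler0_norm ?subr_le0 // opprB ltrBlDl.
Qed.

Lemma asymp_dist_le (R : realType) (G H : sgraph) (e : R) : 0 <= e ->
  (forall F : sgraph -> R, asymptotic_spectrum F -> `|F G - F H| <= e) ->
  0 <= asymp_dist R G H <= e.
Proof.
move=> e0 Fe; rewrite /asymp_dist; set D := [set x | _].
(* the supremum of the empty set is [0] by convention *)
have [->|/set0P[x Dx]] := eqVneq D classical_sets.set0; first by rewrite sup0 lexx.
have De : ubound D e by move=> _ [F FX ->]; exact: Fe.
apply/andP; split; last by apply: ge_sup De; exists x.
apply: le_trans (ub_le_sup _ Dx); last by exists e.
by case: Dx => F _ ->.
Qed.

Lemma asymp_cvg_above (R : realType) a b (p q : nat -> nat) : frac_ge2 a b ->
  (forall n, frac_ge2 (p n) (q n)) ->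
  (forall n, a%:R / b%:R <= (p n)%:R / (q n)%:R :> R) ->
  (p n)%:R / (q n)%:R @[n --> \oo] --> (a%:R / b%:R : R) ->
  asymp_cvg R (fun n => fraction_graph (p n) (q n)) (fraction_graph a b).
Proof.
move=> ab pq le_ab /cvgrPdist_lt pq_cvg; apply/cvgrPdist_le => e e0.
have [d d0 near_ab] := right_continuity_spectrum ab e0.
apply: filterS (pq_cvg d d0) => n.
rewrite ler0_norm ?subr_le0 // opprB ltrBlDl => lt_d.
rewrite sub0r normrN.
have /andP[D0 De] : 0 <= asymp_dist R (fraction_graph (p n) (q n))
    (fraction_graph a b) <= e.
  apply: asymp_dist_le; first exact: ltW.
  move=> F FX; have [F1 F2] := near_ab F FX _ _ (pq n) (le_ab n) lt_d.
  by rewrite ger0_norm ?subr_ge0 // lerBlDl ltW.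
by rewrite ger0_norm.
Qed.

Theorem theorem3p7 (R : realType) :
  [/\ (* f is the function p/q |-> F(E_{p/q}), determined on rationals >= 2 *)
      forall F : sgraph -> R,
        [\/ asymptotic_spectrum F, F = @independence_number R
          | F = @shannon_capacity R] ->
        exists f : rat -> R,
          (forall p q : nat, frac_ge2 p q ->
             f (p%:R / q%:R) = F (fraction_graph p q)) /\
          right_continuous_ge2 f,
      forall p' q' : nat, frac_ge2 p' q' ->
      forall e : R, 0 < e ->
      exists2 d : R, 0 < d &
        forall F : sgraph -> R, asymptotic_spectrum F ->
        forall p q : nat, frac_ge2 p q ->
          p'%:R / q'%:R <= p%:R / q%:R :> R ->
          p%:R / q%:R < p'%:R / q'%:R + d :> R ->
          F (fraction_graph p' q') <= F (fraction_graph p q) /\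
          F (fraction_graph p q) < F (fraction_graph p' q') + e
    & forall a b : nat, frac_ge2 a b ->
      forall p q : nat -> nat,
        (forall n, frac_ge2 (p n) (q n)) ->
        (forall n, a%:R / b%:R <= (p n)%:R / (q n)%:R :> R) ->
        (p n)%:R / (q n)%:R @[n --> \oo] --> (a%:R / b%:R : R) ->
        asymp_cvg R (fun n => fraction_graph (p n) (q n)) (fraction_graph a b)].
Proof.
split.
- exact: right_continuous_parameter.
- by move=> p' q' pq e e0; exact: right_continuity_spectrum.
- by move=> a b ab p q; exact: asymp_cvg_above.
Qed.
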